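(* Let $a>0$, $g\in\mathbb R$, and consider the integrable Hamiltonian system on the orbit $M^4_{a,g}$ with Hamiltonian $$H=\frac12\Bigl(S_1^2+S_2^2+\frac{S_3^2}\beta\Bigr)+g_1(\mathbf R^2,R_3)(S_1R_2-S_2R_1)+g_2(\mathbf R^2,R_3)\langle\mathbf S,\mathbf R\rangle+g_3(\mathbf R^2,R_3)S_3+V(\mathbf R^2,R_3)$$ and integral $K=S_3$. The set $\Sigma_1\subset\mathbb R^2(h,k)$ of images under $(H,K)$ of the singular points of rank $1$ lying in $M^4_{a,g}$ is the union of the following parametric curves and points: 1) the pairs of curves $(h_\pm(x),k_\pm(x))$, $x\in I$, for each $I\in\mathcal I_{a,g}$, where $$h_\pm(x)=\frac{(g-k_\pm(x)x)^2}{2(a-x^2)}+\frac{k_\pm^2(x)}{2\beta}-\frac{(a-x^2)g_1^2}2+g_2g+g_3k_\pm(x)+V,$$ $$k_\pm(x)=\frac{g(a+x^2)}{2ax}-\frac{(a-x^2)^2}{2ax}\frac{\partial g_3}{\partial x}\pm\frac{a-x^2}{2ax}\sqrt{\Bigl(g-(a+x^2)\frac{\partial g_3}{\partial x}\Bigr)^2-4ax\Bigl(xg_1^2-(a-x^2)g_1\frac{\partial g_1}{\partial x}+g\frac{\partial g_2}{\partial x}+x\Bigl(\frac{\partial g_3}{\partial x}\Bigr)^2+\frac{\partial V}{\partial x}\Bigr)},$$ with $g_1,g_2,g_3,V$ and their derivatives evaluated at $(a,x)$; 2) the points $(h(x_0),k(x_0))$ for each $x_0\in\Theta^0_{a,g}$,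 where $$h(x_0)=\frac{(g-k(x_0)x_0)^2}{2(a-x_0^2)}+\frac{k^2(x_0)}{2\beta}-\frac{(a-x_0^2)g_1^2}2+g_2g+g_3k(x_0)+V,$$ $$k(x_0)=\frac{g(a+x_0^2)}{2ax_0}-\frac{(a-x_0^2)^2}{2ax_0}\frac{\partial g_3}{\partial x}(a,x_0),$$ with $g_1,g_2,g_3,V$ evaluated at $(a,x_0)$; 3) for the orbits $M^4_{a,g}$ with $g\ne a\frac{\partial g_3}{\partial x}(a,0)$, the point $(h_0,k_0)$, where $$h_0=\frac{g^2}{2a}+\frac{k_0^2}{2\beta}-\frac{ag_1^2(a,0)}2+g_2(a,0)g+g_3(a,0)k_0+V(a,0),$$ $$k_0=\frac{ag_1(a,0)\frac{\partial g_1}{\partial x}(a,0)-g\frac{\partial g_2}{\partial x}(a,0)-\frac{\partial V}{\partial x}(a,0)}{\frac{\partial g_3}{\partial x}(a,0)-\frac ga};$$ 4) for the orbits $M^4_{a,g}$ where $g=a\frac{\partial g_3}{\partial x}(a,0)$ and $a$ satisfies $$ag_1(a,0)\frac{\partial g_1}{\partial x}(a,0)-a\frac{\partial g_3}{\partial x}(a,0)\frac{\partial g_2}{\partial x}(a,0)-\frac{\partial V}{\partial x}(a,0)=0,$$ the parabola $$h=\frac{k^2}{2\beta}+g_3(a,0)k+\frac a2\Bigl(\frac{\partial g_3}{\partial x}(a,0)\Bigr)^2-\frac a2g_1^2(a,0)+a\frac{\partial g_3}{\partial x}(a,0)g_2(a,0)+V(a,0).$$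
   Context: On $\mathrm e(3)^*=\mathbb R^6$ with linear coordinates $(\mathbf S,\mathbf R)=(S_1,S_2,S_3,R_1,R_2,R_3)$ consider the Lie–Poisson bracket $\{S_i,S_j\}=\varepsilon_{ijk}S_k$, $\{S_i,R_j\}=\varepsilon_{ijk}R_k$, $\{R_i,R_j\}=0$. For a smooth function $f$, $\mathrm{sgrad} f$ is the Hamiltonian vector field $\dot x_i=\{x_i,f\}$. For $a>0$, $M^4_{a,g}=\{\langle\mathbf R,\mathbf R\rangle=a,\ \langle\mathbf S,\mathbf R\rangle=g\}$ is a symplectic leaf; $\mathbf R^2=\langle\mathbf R,\mathbf R\rangle$. In the Hamiltonian, $\beta>0$ is a constant and $g_1,g_2,g_3,V$ are smooth functions of two variables $(a,x)$ (the values of $\mathbf R^2$ and $R_3$) in the range $a>0$, $x^2\le a$; $\partial/\partial x$ is the derivative with respect to the second argument. A singular point of rank $1$ is a point where the span of $\mathrm{sgrad} H$, $\mathrm{sgrad} K$ is one-dimensional. Put, with $g_i,V$ and their derivatives evaluated at $(a,x)$, $$D_{a,g}(x)=\frac1{(a-x^2)^2}\Bigl(g-(a+x^2)\frac{\partial g_3}{\partial x}\Bigr)^2-\frac{4ax}{(a-x^2)^2}\Bigl(xg_1^2-(a-x^2)g_1\frac{\partial g_1}{\partial x}+g\frac{\partial g_2}{\partial x}+x\Bigl(\frac{\partial g_3}{\partial x}\Bigr)^2+\frac{\partial V}{\partial x}\Bigr)$$ and $\Theta_{a,g}=\{x\in\mathbb R\mid x^2<a,\ x\ne0,\ D_{a,g}(x)\ge0\}$.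 Each (arcwise) connected component of $\Theta_{a,g}$ is an interval, either non-degenerate (of non-zero length) or degenerate (a single point). $\mathcal I_{a,g}$ is the set of all non-degenerate intervals among these components, and $\Theta^0_{a,g}$ is the set of the points that are degenerate components. *)

(* Defs.v *)
From HB Require Import structures.
From mathcomp Require Import all_boot all_order all_algebra.
From mathcomp Require Import all_classical all_reals all_analysis.

Set Implicit Arguments.
Unset Strict Implicit.
Unset Printing Implicit Defensive.

Import Order.TTheory GRing.Theory Num.Theory.
Import numFieldNormedType.Exports.

Local Open Scope classical_set_scope.
Local Open Scope ring_scope.

Section Smooth.
Context {R : realType} {V : normedModType R}.

(* Meant for U open: F is of class C^(n+1) iff it is differentiable and its
   differential, i.e. every directional derivative, is of class C^n. *)
Fixpoint class_C (n : nat) (U : set V) (F : V -> R) : Prop :=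
  match n with
  | 0%N => forall p, U p -> {for p, continuous F}
  | m.+1 => (forall p, U p -> differentiable F p) /\
            (forall v : V, class_C m U (fun p => 'D_v F p))
  end.

(* Smoothness on a subset that need not be open: local extendability to a
   C^oo function. *)
Definition smooth_on (A : set V) (f : V -> R) : Prop :=
  forall p, A p -> exists U (F : V -> R),
    [/\ open U, U p, forall n, class_C n U F &
        forall q, U q -> A q -> f q = F q].

End Smooth.

Section LiePoisson.
Context {R : realType}.

(* A point of e(3)^* is the row of its coordinates (S_1, S_2, S_3, R_1, R_2,
   R_3); the indices 1, 2, 3 become the elements 0, 1, 2 of 'I_3. *)
Definition Svec (p : 'rV[R]_(3 + 3)) : 'rV[R]_3 := lsubmx p.
Definition Rvec (p : 'rV[R]_(3 + 3)) : 'rV[R]_3 := rsubmx p.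

Definition dotp (u v : 'rV[R]_3) : R := \sum_i u 0 i * v 0 i.

(* Addition on 'I_3 is modulo 3, so the even orderings are (i, i + 1, i + 2). *)
Definition levi_civita (i j k : 'I_3) : R :=
  if (j == i + 1) && (k == j + 1) then 1
  else if (i == j + 1) && (k == i + 1) then -1
  else 0.

Definition poisson_tensor (p : 'rV[R]_(3 + 3)) : 'M[R]_(3 + 3) :=
  block_mx (\matrix_(i, j) \sum_k levi_civita i j k * Svec p 0 k)
           (\matrix_(i, j) \sum_k levi_civita i j k * Rvec p 0 k)
           (\matrix_(i, j) \sum_k levi_civita i j k * Rvec p 0 k)
           0.

Definition partial (i : 'I_(3 + 3)) (f : 'rV[R]_(3 + 3) -> R)
    (p : 'rV[R]_(3 + 3)) : R :=
  'D_(delta_mx 0 i) f p.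

Definition bracket (f h : 'rV[R]_(3 + 3) -> R) (p : 'rV[R]_(3 + 3)) : R :=
  \sum_i \sum_j poisson_tensor p i j * partial i f p * partial j h p.

Definition sgrad (f : 'rV[R]_(3 + 3) -> R) (p : 'rV[R]_(3 + 3)) :
    'rV[R]_(3 + 3) :=
  \row_i bracket (fun q => q 0 i) f p.

Definition orbit4 (a g : R) : set 'rV[R]_(3 + 3) :=
  [set p | dotp (Rvec p) (Rvec p) = a /\ dotp (Svec p) (Rvec p) = g].

Definition rank1_point (H K : 'rV[R]_(3 + 3) -> R) (p : 'rV[R]_(3 + 3)) :
    Prop :=
  \dim <<[:: sgrad H p; sgrad K p]>>%VS = 1%N.

Definition Sigma1 (H K : 'rV[R]_(3 + 3) -> R) (a g : R) : set (R * R) :=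
  [set (H p, K p) | p in [set p | orbit4 a g p /\ rank1_point H K p]].

End LiePoisson.

Section System.
Context {R : realType}.
Variables (beta : R) (g1 g2 g3 V : R -> R -> R).

Definition potential_domain : set (R * R) :=
  [set ax | 0 < ax.1 /\ ax.2 ^+ 2 <= ax.1].

Definition smooth_potential (f : R -> R -> R) : Prop :=
  smooth_on potential_domain (fun ax : R * R => f ax.1 ax.2).

Definition hamH (p : 'rV[R]_(3 + 3)) : R :=
  let S1 := Svec p 0 0 in let S2 := Svec p 0 1 in let S3 := Svec p 0 2 in
  let R1 := Rvec p 0 0 in let R2 := Rvec p 0 1 in let R3 := Rvec p 0 2 in
  let RR := dotp (Rvec p) (Rvec p) in
  2^-1 * (S1 ^+ 2 + S2 ^+ 2 + S3 ^+ 2 / beta)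
  + g1 RR R3 * (S1 * R2 - S2 * R1)
  + g2 RR R3 * dotp (Svec p) (Rvec p)
  + g3 RR R3 * S3
  + V RR R3.

Definition intK (p : 'rV[R]_(3 + 3)) : R := Svec p 0 2.

Definition dx (f : R -> R -> R) (a x : R) : R := derive1 (f a) x.

Variables a g : R.

Definition Dfun (x : R) : R :=
  ((a - x ^+ 2) ^+ 2)^-1 * (g - (a + x ^+ 2) * dx g3 a x) ^+ 2
  - 4 * a * x / (a - x ^+ 2) ^+ 2
    * (x * g1 a x ^+ 2 - (a - x ^+ 2) * g1 a x * dx g1 a x
       + g * dx g2 a x + x * dx g3 a x ^+ 2 + dx V a x).

Definition Theta : set R :=
  [set x | [/\ x ^+ 2 < a, x != 0 & 0 <= Dfun x]].

Definition Theta_components : set (set R) :=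
  [set connected_component Theta x | x in Theta].

Definition Iset : set (set R) :=
  [set I | Theta_components I /\ exists x y, [/\ I x, I y & x != y]].

Definition Theta0 : set R := [set x | Theta_components [set x]].

Definition hval (k x : R) : R :=
  (g - k * x) ^+ 2 / (2 * (a - x ^+ 2)) + k ^+ 2 / (2 * beta)
  - (a - x ^+ 2) * g1 a x ^+ 2 / 2 + g2 a x * g + g3 a x * k + V a x.

(* The two signs are e = 1 and e = -1. *)
Definition kcurve (e x : R) : R :=
  g * (a + x ^+ 2) / (2 * a * x)
  - (a - x ^+ 2) ^+ 2 / (2 * a * x) * dx g3 a x
  + e * ((a - x ^+ 2) / (2 * a * x)
    * Num.sqrt ((g - (a + x ^+ 2) * dx g3 a x) ^+ 2
        - 4 * a * x * (x * g1 a x ^+ 2 - (a - x ^+ 2) * g1 a x * dx g1 a x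
            + g * dx g2 a x + x * dx g3 a x ^+ 2 + dx V a x))).

Definition kdeg (x : R) : R :=
  g * (a + x ^+ 2) / (2 * a * x)
  - (a - x ^+ 2) ^+ 2 / (2 * a * x) * dx g3 a x.

Definition curve (e x : R) : R * R := (hval (kcurve e x) x, kcurve e x).

Definition k0 : R :=
  (a * g1 a 0 * dx g1 a 0 - g * dx g2 a 0 - dx V a 0) / (dx g3 a 0 - g / a).

Definition h0 : R :=
  g ^+ 2 / (2 * a) + k0 ^+ 2 / (2 * beta) - a * g1 a 0 ^+ 2 / 2
  + g2 a 0 * g + g3 a 0 * k0 + V a 0.

Definition hparabola (k : R) : R :=
  k ^+ 2 / (2 * beta) + g3 a 0 * k + a / 2 * dx g3 a 0 ^+ 2
  - a / 2 * g1 a 0 ^+ 2 + a * dx g3 a 0 * g2 a 0 + V a 0.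

End System.

(* Main.v *)
(** At the poles R_1 = R_2 = 0 the rank is 0 or 2. Elsewhere sgrad K does not vanish,
    and sgrad (H - l K) = 0 means that d(H - l K) lies in the span of the
    differentials of the two Casimirs. With w = R_1^2 + R_2^2 = a - x^2, x = R_3
    and k = S_3 this amounts to S_1 = m R_1 - g_1 R_2, S_2 = m R_2 + g_1 R_1 with
    m = (g - k x) / w, together with one scalar equation, which after
    multiplication by w^2 is quadratic in k with leading coefficient a x. Its
    discriminant is w^4 D_{a,g}(x), whence the two branches k_+ and k_- over
    Theta_{a,g}; at x = 0 the equation is linear and gives the point (h_0, k_0)
    or the parabola. At a degenerate component D_{a,g} vanishes, by continuity,
    so that both branches reduce to k(x_0). *)
Require Import Defs.
From HB Require Import structures.
From mathcomp Require Import all_boot all_order all_algebra.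
From mathcomp Require Import all_classical all_reals all_analysis.
From mathcomp Require Import ring lra.

Set Implicit Arguments.
Unset Strict Implicit.
Unset Printing Implicit Defensive.

Import Order.TTheory GRing.Theory Num.Theory.
Import numFieldNormedType.Exports.

Local Open Scope classical_set_scope.
Local Open Scope ring_scope.

(** * Coordinate derivatives, the chain rule in two variables, and regularity of the potentials *)

Lemma is_derive_coord (R : realType) n (p v : 'rV[R]_n) (i : 'I_n) :
  is_derive p v (fun q : 'rV[R]_n => q 0 i) (v 0 i).
Proof.
have E : (fun h : R => h^-1 *:
    (((fun q : 'rV[R]_n => q 0 i) \o shift p) (h *: v) - p 0 i)) @ 0^' --> v 0 i.
  apply: cvg_near_cst.
  near=> h.
  rewrite /= !mxE addrK.
  apply: mulKf.
  by near: h; exact: nbhs_dnbhs_neq.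
by apply: DeriveDef; [apply/cvg_ex; exists (v 0 i) | exact: cvg_lim].
Unshelve. all: by end_near. Qed.

(** The differential of [F] is linear, so its value on [(du, dw)] splits along the two basis
    directions. Existence of the partial derivatives alone would not give this, hence the assumption
    of differentiability. *)
Lemma is_derive_comp2 (R : realType) (W : normedModType R) (F : R * R -> R)
    (u w : W -> R) (p v : W) (du dw : R) :
  differentiable F (u p, w p) -> differentiable u p -> differentiable w p ->
  is_derive p v u du -> is_derive p v w dw ->
  is_derive p v (fun q => F (u q, w q))
    ('D_(1, 0) F (u p, w p) * du + 'D_(0, 1) F (u p, w p) * dw).
Proof.
move=> dF diffu diffw du_ dw_.
have diffuw : differentiable (fun q => (u q, w q)) p.
  exact: differentiable_pair.
have diffc : differentiable (F \o (fun q => (u q, w q))) p.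
  exact: differentiable_comp.
apply: DeriveDef; first exact: diff_derivable.
have Eu : 'd u p v = du by rewrite -deriveE // derive_val.
have Ew : 'd w p v = dw by rewrite -deriveE // derive_val.
rewrite deriveE // diff_comp //= diff_pair //= Eu Ew.
have -> : (du, dw) = du *: (1, 0) + dw *: (0, 1) :> R * R.
  by congr pair; rewrite /= /GRing.scale /= ?mulr1 ?mulr0 ?addr0 ?add0r.
by rewrite linearD !linearZ /= /GRing.scale /= -!deriveE // mulrC [X in _ + X = _]mulrC.
Qed.

Lemma cvg_pairl (R : realType) (a x : R) : (fun y : R => (a, y)) @ x --> (a, x).
Proof.
by apply: (@cvg_pair _ _ _ (nbhs x) (nbhs a) (nbhs x));
  [exact: cvg_cst|exact: cvg_id].
Qed.

Lemma near_sqr_lt (R : realType) (a x : R) :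
  x ^+ 2 < a -> \forall y \near x, y ^+ 2 < a.
Proof.
move=> xa; have : (fun y : R => y ^+ 2) @ x --> x ^+ 2 by exact: exprn_continuous.
by move=> /(_ [set z | z < a]); apply; exact: lt_nbhsl.
Qed.

(** [dx] differentiates [f a] itself, whereas smoothness only supplies a local extension [F]. Since
    [x ^+ 2 < a] is an open condition, [f a] agrees with [F (a, _)] near [x]. *)
Lemma dx_extE (R : realType) (f : R -> R -> R) (F : R * R -> R) U (a x : R) :
  open U -> U (a, x) -> 0 < a -> x ^+ 2 < a ->
  (forall q, U q -> potential_domain q -> f q.1 q.2 = F q) ->
  dx f a x = 'D_(0, 1) F (a, x).
Proof.
move=> oU Uax a0 xa fF; rewrite /dx derive1E.
have -> : 'D_1 (f a) x = 'D_1 (fun y => F (a, y)) x.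
  apply: near_eq_derive.
  have Un : \forall y \near x, U (a, y).
    by apply: cvg_pairl; exact: open_nbhs_nbhs.
  near=> y; apply: (fF (a, y)); first by near: y.
  by split=> //=; apply/ltW; near: y; exact: near_sqr_lt.
rewrite /derive; congr (lim (_ @ 0^')); apply/funext => h /=.
by congr (_ *: (F _ - _)); congr pair; rewrite /= scaler0 add0r.
Unshelve. all: by end_near. Qed.

(** Both limits are inherited from a local extension: the first from its continuity, the second from
    that of its derivative in the direction [(0, 1)]. *)
Lemma dx_continuous (R : realType) (f : R -> R -> R) (a x : R) :
  smooth_potential f -> 0 < a -> x ^+ 2 < a ->
  f a @ x --> f a x /\ dx f a @ x --> dx f a x.
Proof.
move=> fs a0 xa; have [U [F [oU Ux cF fF]]] := fs (a, x) (conj a0 (ltW xa)).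
have Un : \forall y \near x, U (a, y).
  by apply: cvg_pairl; exact: open_nbhs_nbhs.
split.
- have <- : F (a, x) = f a x by rewrite -fF //; split=> //; exact: ltW.
  have : (fun y => F (a, y)) @ x --> F (a, x).
    exact: cvg_comp _ _ (@cvg_pairl R a x) (cF 0%N (a, x) Ux).
  apply: cvg_trans; apply: near_eq_cvg; near=> y.
  rewrite -fF //; first by near: y.
  by split=> //=; apply/ltW; near: y; exact: near_sqr_lt.
- rewrite (dx_extE oU Ux a0 xa fF).
  have : (fun y => 'D_(0, 1) F (a, y)) @ x --> 'D_(0, 1) F (a, x).
    have [_ /(_ (0, 1)) c1] := cF 1%N.
    exact: cvg_comp _ _ (@cvg_pairl R a x) (c1 (a, x) Ux).
  apply: cvg_trans; apply: near_eq_cvg; near=> y.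
  apply/esym/(dx_extE oU _ a0 _ fF); first by near: y.
  by near: y; exact: near_sqr_lt.
Unshelve. all: by end_near. Qed.

(** * Hamiltonian vector fields in coordinates *)

Lemma sum3 (M : nmodType) (F : 'I_3 -> M) : \sum_i F i = F 0 + F 1 + F 2.
Proof.
rewrite !big_ord_recl big_ord0 addr0 addrA.
by congr (_ + F _ + F _); apply: val_inj.
Qed.

Lemma dotp3 (R : realType) (u v : 'rV[R]_3) :
  dotp u v = u 0 0 * v 0 0 + u 0 1 * v 0 1 + u 0 2 * v 0 2.
Proof. exact: sum3. Qed.

(** Component [i] of the cross product of [y] and [u], with indices modulo 3. *)
Lemma levi_civita_sum (R : realType) (i : 'I_3) (u : 'rV[R]_3) (y : 'I_3 -> R):
  \sum_j (\sum_k levi_civita i j k * u 0 k) * y j =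
  u 0 (i + 2) * y (i + 1) - u 0 (i + 1) * y (i + 2).
Proof.
rewrite !sum3 /levi_civita.
case: i => [[|[|[|//]]] Hi].
- have -> : (Ordinal Hi + 1 = 1)%R by apply: val_inj.
  have -> : (Ordinal Hi + 2 = 2)%R by apply: val_inj.
  by simpl; ring.
- have -> : (Ordinal Hi + 1 = 2)%R by apply: val_inj.
  have -> : (Ordinal Hi + 2 = 0)%R by apply: val_inj.
  by simpl; ring.
- have -> : (Ordinal Hi + 1 = 0)%R by apply: val_inj.
  have -> : (Ordinal Hi + 2 = 1)%R by apply: val_inj.
  by simpl; ring.
Qed.

Lemma partial_coord (R : realType) (p : 'rV[R]_(3 + 3)) i k :
  partial k (fun q => q 0 i) p = (i == k)%:R.
Proof.
have D := is_derive_coord p (delta_mx 0 k) i.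
by rewrite /partial derive_val mxE eqxx.
Qed.

Lemma sgrad_coord (R : realType) (f : 'rV[R]_(3 + 3) -> R) p i :
  sgrad f p 0 i = \sum_j poisson_tensor p i j * partial j f p.
Proof.
rewrite mxE /bracket (bigD1 i) //= [X in _ + X]big1 ?addr0.
  by apply: eq_bigr => j _; rewrite partial_coord eqxx mulr1.
move=> k ki; apply: big1 => j _.
by rewrite partial_coord eq_sym (negbTE ki) mulr0 mul0r.
Qed.

(** Together with [Rvec_sgrad] this is the vector form of the flow: S' is the sum of the cross
    products of f_S with S and of f_R with R, and R' is that of f_S with R, where f_S and f_R are
    the two halves of the gradient. *)
Lemma Svec_sgrad (R : realType) (f : 'rV[R]_(3 + 3) -> R) p i :
  Svec (sgrad f p) 0 i =
  Svec p 0 (i + 2) * partial (lshift 3 (i + 1)) f p -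
  Svec p 0 (i + 1) * partial (lshift 3 (i + 2)) f p +
  (Rvec p 0 (i + 2) * partial (rshift 3 (i + 1)) f p -
  Rvec p 0 (i + 1) * partial (rshift 3 (i + 2)) f p).
Proof.
rewrite mxE sgrad_coord big_split_ord /=; congr (_ + _).
  under eq_bigr do rewrite /poisson_tensor block_mxEul mxE.
  by rewrite (levi_civita_sum i _ (fun j => partial (lshift 3 j) f p)).
under eq_bigr do rewrite /poisson_tensor block_mxEur mxE.
by rewrite (levi_civita_sum i _ (fun j => partial (rshift 3 j) f p)).
Qed.

Lemma Rvec_sgrad (R : realType) (f : 'rV[R]_(3 + 3) -> R) p i :
  Rvec (sgrad f p) 0 i =
  Rvec p 0 (i + 2) * partial (lshift 3 (i + 1)) f p -
  Rvec p 0 (i + 1) * partial (lshift 3 (i + 2)) f p.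
Proof.
rewrite mxE sgrad_coord big_split_ord /= [X in _ + X]big1 ?addr0.
  under eq_bigr do rewrite /poisson_tensor block_mxEdl mxE.
  by rewrite (levi_civita_sum i _ (fun j => partial (lshift 3 j) f p)).
by move=> j _; rewrite /poisson_tensor block_mxEdr mxE mul0r.
Qed.

(** * The differential of the Hamiltonian *)

Lemma is_derive_Svec (R : realType) (p v : 'rV[R]_(3 + 3)) i :
  is_derive p v (fun q => Svec q 0 i) (Svec v 0 i).
Proof.
have -> : (fun q : 'rV[R]_(3 + 3) => Svec q 0 i) = (fun q => q 0 (lshift 3 i)).
  by apply/funext => q; rewrite mxE.
by rewrite mxE; exact: is_derive_coord.
Qed.

Lemma is_derive_Rvec (R : realType) (p v : 'rV[R]_(3 + 3)) i :
  is_derive p v (fun q => Rvec q 0 i) (Rvec v 0 i).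
Proof.
have -> : (fun q : 'rV[R]_(3 + 3) => Rvec q 0 i) = (fun q => q 0 (rshift 3 i)).
  by apply/funext => q; rewrite mxE.
by rewrite mxE; exact: is_derive_coord.
Qed.

Lemma differentiable_Rvec (R : realType) (p : 'rV[R]_(3 + 3)) i :
  differentiable (fun q => Rvec q 0 i) p.
Proof.
have -> : (fun q : 'rV[R]_(3 + 3) => Rvec q 0 i) = (fun q => q 0 (rshift 3 i)).
  by apply/funext => q; rewrite mxE.
exact: differentiable_coord.
Qed.

Section PointwiseDerivation.
Variables (R : realType) (W : normedModType R) (p v : W) (f h : W -> R).
Variables (df dh : R).
Hypotheses (Hf : is_derive p v f df) (Hh : is_derive p v h dh).

Lemma is_derive_add : is_derive p v (fun q => f q + h q) (df + dh).
Proof. exact: is_deriveD. Qed.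

Lemma is_derive_sub : is_derive p v (fun q => f q - h q) (df - dh).
Proof. exact: is_deriveB. Qed.

Lemma is_derive_mul : is_derive p v (fun q => f q * h q) (f p * dh + h p * df).
Proof. exact: is_deriveM. Qed.

Lemma is_derive_const (c : R) : is_derive p v (fun=> c) 0.
Proof. exact: is_derive_cst. Qed.

End PointwiseDerivation.

Lemma is_derive_sqr (R : realType) (W : normedModType R) (p v : W) (f : W -> R)
    (df : R) :
  is_derive p v f df -> is_derive p v (fun q => f q ^+ 2) (2 * f p * df).
Proof.
move=> Hf.
have -> : (fun q => f q ^+ 2) = (fun q => f q * f q).
  by apply/funext => q; rewrite expr2.
refine (is_derive_eq (is_derive_mul Hf Hf) _).
by ring.
Qed.

Lemma is_derive_RR (R : realType) (p v : 'rV[R]_(3 + 3)) :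
  is_derive p v (fun q => dotp (Rvec q) (Rvec q)) (2 * dotp (Rvec p) (Rvec v)).
Proof.
have -> : (fun q : 'rV[R]_(3 + 3) => dotp (Rvec q) (Rvec q)) =
    (fun q => Rvec q 0 0 * Rvec q 0 0 + Rvec q 0 1 * Rvec q 0 1 +
              Rvec q 0 2 * Rvec q 0 2).
  by apply/funext => q; rewrite dotp3.
have D i := is_derive_Rvec p v i.
refine (is_derive_eq (is_derive_add (is_derive_add (is_derive_mul (D 0) (D 0))
  (is_derive_mul (D 1) (D 1))) (is_derive_mul (D 2) (D 2))) _).
by rewrite dotp3; ring.
Qed.

Lemma differentiable_RR (R : realType) (p : 'rV[R]_(3 + 3)) :
  differentiable (fun q => dotp (Rvec q) (Rvec q)) p.
Proof.
have -> : (fun q : 'rV[R]_(3 + 3) => dotp (Rvec q) (Rvec q)) =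
    (fun q => Rvec q 0 0 * Rvec q 0 0 + Rvec q 0 1 * Rvec q 0 1 +
              Rvec q 0 2 * Rvec q 0 2).
  by apply/funext => q; rewrite dotp3.
by apply: differentiableD; first apply: differentiableD; apply: differentiableM;
  exact: differentiable_Rvec.
Qed.

(* The poles x^2 = a are boundary points of the domain of f, where [dx f] is
   meaningless; the chain rule still holds there for an extension of f. *)
Lemma potential_is_derive (R : realType) (f : R -> R -> R) (p : 'rV[R]_(3 + 3)) :
  smooth_potential f -> 0 < dotp (Rvec p) (Rvec p) ->
  exists A X : R,
    (forall v, is_derive p v (fun q => f (dotp (Rvec q) (Rvec q)) (Rvec q 0 2))
                 (2 * dotp (Rvec p) (Rvec v) * A + Rvec v 0 2 * X)) /\
    (Rvec p 0 2 ^+ 2 < dotp (Rvec p) (Rvec p) ->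
      X = dx f (dotp (Rvec p) (Rvec p)) (Rvec p 0 2)).
Proof.
move=> fs a0.
have dom (q : 'rV[R]_(3 + 3)) : 0 < dotp (Rvec q) (Rvec q) ->
    potential_domain (dotp (Rvec q) (Rvec q), Rvec q 0 2).
  by move=> q0; split=> //=; rewrite dotp3; nra.
have [U [F [oU Up cF fF]]] := fs _ (dom p a0).
pose phi (q : 'rV[R]_(3 + 3)) : R * R := (dotp (Rvec q) (Rvec q), Rvec q 0 2).
have dF : differentiable F (phi p) by have [+ _] := cF 1%N; exact.
exists ('D_(1, 0) F (phi p)), ('D_(0, 1) F (phi p)); split.
- move=> v; apply: (@near_eq_is_derive _ _ _ (F \o phi)).
    have cphi : {for p, continuous phi}.
      by apply/differentiable_continuous/differentiable_pair;
        [exact: differentiable_RR|exact: differentiable_Rvec].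
    have cRR : {for p, continuous (fun q : 'rV[R]_(3 + 3) => dotp (Rvec q) (Rvec q))}.
      exact/differentiable_continuous/differentiable_RR.
    near=> q; rewrite /= -fF //.
      near: q; exact: (cphi U (open_nbhs_nbhs (conj oU Up))).
    apply: dom; near: q; exact: (cRR _ (lt_nbhsr a0)).
  refine (is_derive_eq (@is_derive_comp2 _ _ F
    (fun q => dotp (Rvec q) (Rvec q)) (fun q => Rvec q 0 2) p v _ _ dF
    (differentiable_RR p) (differentiable_Rvec p 2) (is_derive_RR p v)
    (is_derive_Rvec p v 2)) _).
  by ring.
- by move=> xa; rewrite (dx_extE oU Up a0 xa fF).
Unshelve. all: by end_near. Qed.

(** Derivatives in the first argument of the potentials enter only through [nu] times R, a multiple
    of the gradient of the Casimir R^2, and cancel in the vector field. Those in the second argument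
    make up [B], which is identified only off the poles. *)
Lemma hamH_is_derive (R : realType) (beta : R) (g1 g2 g3 V : R -> R -> R)
    (p : 'rV[R]_(3 + 3)) :
  smooth_potential g1 -> smooth_potential g2 -> smooth_potential g3 ->
  smooth_potential V -> 0 < dotp (Rvec p) (Rvec p) ->
  let a := dotp (Rvec p) (Rvec p) in let g := dotp (Svec p) (Rvec p) in
  let S1 := Svec p 0 0 in let S2 := Svec p 0 1 in let S3 := Svec p 0 2 in
  let R1 := Rvec p 0 0 in let R2 := Rvec p 0 1 in let x := Rvec p 0 2 in
  exists nu B : R,
    (forall v, is_derive p v (hamH beta g1 g2 g3 V)
      ((S1 + g1 a x * R2 + g2 a x * R1) * Svec v 0 0 +
       (S2 - g1 a x * R1 + g2 a x * R2) * Svec v 0 1 +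
       (S3 / beta + g2 a x * x + g3 a x) * Svec v 0 2 +
       (g2 a x * S1 - g1 a x * S2 + nu * R1) * Rvec v 0 0 +
       (g2 a x * S2 + g1 a x * S1 + nu * R2) * Rvec v 0 1 +
       (g2 a x * S3 + B + nu * x) * Rvec v 0 2)) /\
    (x ^+ 2 < a -> B = dx g1 a x * (S1 * R2 - S2 * R1) + dx g2 a x * g +
                       dx g3 a x * S3 + dx V a x).
Proof.
move=> s1 s2 s3 sV a0 a g S1 S2 S3 R1 R2 x.
have [A1 [X1 [D1 E1]]] := potential_is_derive s1 a0.
have [A2 [X2 [D2 E2]]] := potential_is_derive s2 a0.
have [A3 [X3 [D3 E3]]] := potential_is_derive s3 a0.
have [A4 [X4 [D4 E4]]] := potential_is_derive sV a0.
exists (2 * (A1 * (S1 * R2 - S2 * R1) + A2 * g + A3 * S3 + A4)).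
exists (X1 * (S1 * R2 - S2 * R1) + X2 * g + X3 * S3 + X4).
split; last by move=> xa; rewrite E1 // E2 // E3 // E4.
move=> v.
have DS i := is_derive_Svec p v i.
have DR i := is_derive_Rvec p v i.
(* This form fits the derivation rules: the quotient becomes a product and the Casimir S.R is
   expanded, while R^2 stays folded inside the potentials, where [D1] to [D4] apply. *)
have -> : hamH beta g1 g2 g3 V = (fun q =>
    2^-1 * (Svec q 0 0 ^+ 2 + Svec q 0 1 ^+ 2 + Svec q 0 2 ^+ 2 * beta^-1)
    + g1 (dotp (Rvec q) (Rvec q)) (Rvec q 0 2) *
      (Svec q 0 0 * Rvec q 0 1 - Svec q 0 1 * Rvec q 0 0)
    + g2 (dotp (Rvec q) (Rvec q)) (Rvec q 0 2) *
      (Svec q 0 0 * Rvec q 0 0 + Svec q 0 1 * Rvec q 0 1 + Svec q 0 2 * Rvec q 0 2)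
    + g3 (dotp (Rvec q) (Rvec q)) (Rvec q 0 2) * Svec q 0 2
    + V (dotp (Rvec q) (Rvec q)) (Rvec q 0 2)).
  by apply/funext => q; rewrite /hamH [dotp (Svec q) _]dotp3.
refine (is_derive_eq (is_derive_add (is_derive_add (is_derive_add (is_derive_add
   (is_derive_mul (is_derive_const p v 2^-1)
     (is_derive_add (is_derive_add (is_derive_sqr (DS 0)) (is_derive_sqr (DS 1)))
       (is_derive_mul (is_derive_sqr (DS 2)) (is_derive_const p v beta^-1))))
   (is_derive_mul (D1 v) (is_derive_sub (is_derive_mul (DS 0) (DR 1))
     (is_derive_mul (DS 1) (DR 0)))))
   (is_derive_mul (D2 v) (is_derive_add (is_derive_add (is_derive_mul (DS 0) (DR 0))
      (is_derive_mul (DS 1) (DR 1))) (is_derive_mul (DS 2) (DR 2)))))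
   (is_derive_mul (D3 v) (DS 2))) (D4 v)) _).
rewrite /g !dotp3 -!dotp3 -/a -/S1 -/S2 -/S3 -/R1 -/R2 -/x.
rewrite (dotp3 (Rvec p) (Rvec v)) /g dotp3 -/S1 -/S2 -/S3 -/R1 -/R2 -/x.
by move: beta^-1 => b; field.
Qed.

(** * Points of rank one *)

Lemma ord3_add :
  (((0 + 1)%R = 1%R :> 'I_3) *
   ((0 + 2)%R = 2%R :> 'I_3) *
   ((1 + 1)%R = 2%R :> 'I_3) *
   ((1 + 2)%R = 0%R :> 'I_3) *
   ((2 + 1)%R = 0%R :> 'I_3) *
   ((2 + 2)%R = 1%R :> 'I_3))%type.
Proof. by do !split; apply: val_inj. Qed.

Lemma ord3P (P : 'I_3 -> Prop) : P 0 -> P 1 -> P 2 -> forall i, P i.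
Proof.
move=> P0 P1 P2 [[|[|[|//]]] Hi].
- by rewrite (_ : Ordinal Hi = 0) //; apply: val_inj.
- by rewrite (_ : Ordinal Hi = 1) //; apply: val_inj.
- by rewrite (_ : Ordinal Hi = 2) //; apply: val_inj.
Qed.

Lemma Svec_deltaS (R : realType) (i j : 'I_3) :
  Svec (delta_mx 0 (lshift 3 i) : 'rV[R]_(3 + 3)) 0 j = (j == i)%:R.
Proof. by rewrite !mxE eqxx eq_lshift. Qed.

Lemma Rvec_deltaS (R : realType) (i j : 'I_3) :
  Rvec (delta_mx 0 (lshift 3 i) : 'rV[R]_(3 + 3)) 0 j = 0.
Proof. by rewrite !mxE eqxx eq_rlshift. Qed.

Lemma Svec_deltaR (R : realType) (i j : 'I_3) :
  Svec (delta_mx 0 (rshift 3 i) : 'rV[R]_(3 + 3)) 0 j = 0.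
Proof. by rewrite !mxE eqxx eq_lrshift. Qed.

Lemma Rvec_deltaR (R : realType) (i j : 'I_3) :
  Rvec (delta_mx 0 (rshift 3 i) : 'rV[R]_(3 + 3)) 0 j = (j == i)%:R.
Proof. by rewrite !mxE eqxx eq_rshift. Qed.

Lemma intK_partialS (R : realType) (p : 'rV[R]_(3 + 3)) i :
  partial (lshift 3 i) intK p = (i == 2)%:R.
Proof.
have D := is_derive_Svec p (delta_mx 0 (lshift 3 i)) 2.
by rewrite /partial /intK derive_val Svec_deltaS eq_sym.
Qed.

Lemma intK_partialR (R : realType) (p : 'rV[R]_(3 + 3)) i :
  partial (rshift 3 i) intK p = 0.
Proof.
have D := is_derive_Svec p (delta_mx 0 (rshift 3 i)) 2.
by rewrite /partial /intK derive_val Svec_deltaR.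
Qed.

Lemma rank1P (R : realType) (H K : 'rV[R]_(3 + 3) -> R) p :
  rank1_point H K p -> sgrad K p != 0 ->
  exists l, sgrad H p = l *: sgrad K p.
Proof.
move=> r1 K0; apply/vlineP.
have sub : (<[sgrad K p]> <= <<[:: sgrad H p; sgrad K p]>>)%VS.
  by rewrite -memvE memv_span // !inE eqxx orbT.
suff -> : <[sgrad K p]>%VS = <<[:: sgrad H p; sgrad K p]>>%VS.
  by rewrite memv_span // !inE eqxx.
by apply/eqP; rewrite eqEdim sub r1 dim_vline K0.
Qed.

Lemma rank1_of_prop (R : realType) (H K : 'rV[R]_(3 + 3) -> R) p l :
  sgrad H p = l *: sgrad K p -> sgrad K p != 0 -> rank1_point H K p.
Proof.
move=> E K0; rewrite /rank1_point span_cons span_seq1 E.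
rewrite (_ : (_ + _)%VS = <[sgrad K p]>%VS) ?dim_vline ?K0 //.
by apply/addv_idPr; rewrite -memvE memvZ // memv_line.
Qed.

Lemma row6P (R : realType) (u v : 'rV[R]_(3 + 3)) :
  (forall i, Svec u 0 i = Svec v 0 i) -> (forall i, Rvec u 0 i = Rvec v 0 i) ->
  u = v.
Proof.
move=> ES ER; rewrite -[u]hsubmxK -[v]hsubmxK.
by congr row_mx; apply/rowP => i; [exact: ES|exact: ER].
Qed.

Lemma SvecZ (R : realType) (l : R) (u : 'rV[R]_(3 + 3)) i :
  Svec (l *: u) 0 i = l * Svec u 0 i.
Proof. by rewrite !mxE. Qed.

Lemma RvecZ (R : realType) (l : R) (u : 'rV[R]_(3 + 3)) i :
  Rvec (l *: u) 0 i = l * Rvec u 0 i.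
Proof. by rewrite !mxE. Qed.

(** S_3 generates the simultaneous rotation of S and R about the third axis, so its field vanishes
    exactly when both vectors lie on that axis. *)
Lemma sgrad_intK (R : realType) (p : 'rV[R]_(3 + 3)) :
  [/\ Svec (sgrad intK p) 0 0 = - Svec p 0 1,
      Svec (sgrad intK p) 0 1 = Svec p 0 0 & Svec (sgrad intK p) 0 2 = 0] /\
  [/\ Rvec (sgrad intK p) 0 0 = - Rvec p 0 1,
      Rvec (sgrad intK p) 0 1 = Rvec p 0 0 & Rvec (sgrad intK p) 0 2 = 0].
Proof.
by split; split; rewrite ?Svec_sgrad ?Rvec_sgrad ?intK_partialS ?intK_partialR
  !ord3_add /=; ring.
Qed.

(* The equations say that the gradient of H - l S_3 is in the kernel of the
   Poisson tensor; m + G2 is the factor in the proportionality of its S-part to R. *)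
Lemma proportional_algebra (R : realFieldType)
    (S1 S2 S3 R1 R2 x G1 G2 HS3 B nu l : R) :
  let HS1 := S1 + G1 * R2 + G2 * R1 in
  let HS2 := S2 - G1 * R1 + G2 * R2 in
  let HR1 := G2 * S1 - G1 * S2 + nu * R1 in
  let HR2 := G2 * S2 + G1 * S1 + nu * R2 in
  let HR3 := G2 * S3 + B + nu * x in
  R1 ^+ 2 + R2 ^+ 2 != 0 ->
  S3 * HS2 - S2 * HS3 + (x * HR2 - R2 * HR3) = l * - S2 ->
  S1 * HS3 - S3 * HS1 + (R1 * HR3 - x * HR1) = l * S1 ->
  x * HS2 - R2 * HS3 = l * - R2 ->
  R1 * HS3 - x * HS1 = l * R1 ->
  R2 * HS1 - R1 * HS2 = l * 0 ->
  exists m, [/\ S1 = m * R1 - G1 * R2, S2 = m * R2 + G1 * R1 &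
    B - m * S3 + (G1 ^+ 2 + m ^+ 2) * x = 0].
Proof.
move=> HS1 HS2 HR1 HR2 HR3 w0 s1 s2 r1 r2 r3.
(* [(T1, T2, T3)] is the S-gradient of H - l S_3 minus G2 R. By [r1], [r2], [r3] it is parallel to
   R, and [m] is the factor, found by projecting on [(R1, R2)]. *)
set w := R1 ^+ 2 + R2 ^+ 2 in w0.
pose T1 := S1 + G1 * R2; pose T2 := S2 - G1 * R1.
pose T3 := HS3 - G2 * x - l.
pose m := (R1 * T1 + R2 * T2) / w.
have mw : m * w = R1 * T1 + R2 * T2 by rewrite /m divfK.
have e3 : R2 * T1 = R1 * T2.
  apply/eqP; rewrite -subr_eq0; apply/eqP; rewrite /T1 /T2; move: r3.
  by rewrite /HS1 /HS2 mulr0 => <-; ring.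
have e1 : x * T2 = R2 * T3.
  apply/eqP; rewrite -subr_eq0; apply/eqP; rewrite /T3 /T2; move/eqP: r1.
  by rewrite -subr_eq0 => /eqP <-; rewrite /HS2; ring.
have e2 : R1 * T3 = x * T1.
  apply/eqP; rewrite -subr_eq0; apply/eqP; rewrite /T3 /T1; move/eqP: r2.
  by rewrite -subr_eq0 => /eqP <-; rewrite /HS1; ring.
have t1 : T1 = m * R1.
  apply: (mulIf w0); rewrite mulrAC mw /w.
  have -> : (R1 * T1 + R2 * T2) * R1 = R1 ^+ 2 * T1 + R2 * (R1 * T2) by ring.
  by rewrite -e3; ring.
have t2 : T2 = m * R2.
  apply: (mulIf w0); rewrite mulrAC mw /w.
  have -> : (R1 * T1 + R2 * T2) * R2 = R1 * (R2 * T1) + R2 ^+ 2 * T2 by ring.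
  by rewrite e3; ring.
have t3 : T3 = m * x.
  apply: (mulIf w0); rewrite mulrAC mw /w.
  have -> : T3 * (R1 ^+ 2 + R2 ^+ 2) = R1 * (R1 * T3) + R2 * (R2 * T3) by ring.
  by rewrite e2 -e1; ring.
have E1 : S1 = m * R1 - G1 * R2 by rewrite -t1 /T1; ring.
have E2 : S2 = m * R2 + G1 * R1 by rewrite -t2 /T2; ring.
have E3 : HS3 = m * x + G2 * x + l by rewrite -t3 /T3; ring.
exists m; split => //.
(* The equations [s1] and [s2] only give the last identity multiplied by [R2] and by [R1]; as [w] is
   nonzero, the two products recombine into the identity itself. *)
set E := (X in X = 0).
have f1 : R2 * E = 0.
  move/eqP: s1; rewrite -subr_eq0 => /eqP; rewrite /HS2 /HR2 /HR3 E3 E1 E2 => s1.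
  by rewrite -oppr0 -s1 /E; ring.
have f2 : R1 * E = 0.
  move/eqP: s2; rewrite -subr_eq0 => /eqP; rewrite /HS1 /HR1 /HR3 E3 E1 E2 => s2.
  by rewrite -s2 /E; ring.
apply: (mulfI w0); rewrite mulr0 /w.
have -> : (R1 ^+ 2 + R2 ^+ 2) * E = R1 * (R1 * E) + R2 * (R2 * E) by ring.
by rewrite f1 f2 !mulr0 addr0.
Qed.

Lemma Svec0 (R : realType) i : Svec (0 : 'rV[R]_(3 + 3)) 0 i = 0.
Proof. by rewrite !mxE. Qed.

Lemma Rvec0 (R : realType) i : Rvec (0 : 'rV[R]_(3 + 3)) 0 i = 0.
Proof. by rewrite !mxE. Qed.

Section RankOne.
Variables (R : realType) (beta : R) (g1 g2 g3 V : R -> R -> R).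
Hypotheses (s1 : smooth_potential g1) (s2 : smooth_potential g2)
  (s3 : smooth_potential g3) (sV : smooth_potential V).
Local Notation H := (hamH beta g1 g2 g3 V).
Variable p : 'rV[R]_(3 + 3).
Local Notation a := (dotp (Rvec p) (Rvec p)).
Local Notation g := (dotp (Svec p) (Rvec p)).
Local Notation S1 := (Svec p 0 0).
Local Notation S2 := (Svec p 0 1).
Local Notation S3 := (Svec p 0 2).
Local Notation R1 := (Rvec p 0 0).
Local Notation R2 := (Rvec p 0 1).
Local Notation x := (Rvec p 0 2).

Lemma hamH_partial : 0 < a -> exists nu B : R,
  [/\ [/\ partial (lshift 3 0) H p = S1 + g1 a x * R2 + g2 a x * R1,
          partial (lshift 3 1) H p = S2 - g1 a x * R1 + g2 a x * R2 &
          partial (lshift 3 2) H p = S3 / beta + g2 a x * x + g3 a x],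
      [/\ partial (rshift 3 0) H p = g2 a x * S1 - g1 a x * S2 + nu * R1,
          partial (rshift 3 1) H p = g2 a x * S2 + g1 a x * S1 + nu * R2 &
          partial (rshift 3 2) H p = g2 a x * S3 + B + nu * x] &
      (x ^+ 2 < a -> B = dx g1 a x * (S1 * R2 - S2 * R1) + dx g2 a x * g +
                         dx g3 a x * S3 + dx V a x)].
Proof.
move=> a0; have [nu [B [D HB]]] := hamH_is_derive beta s1 s2 s3 sV a0.
exists nu, B; split=> //; rewrite /partial.
  by split; rewrite (@derive_val _ _ _ _ _ _ _ (D _))
    !Svec_deltaS !Rvec_deltaS /=; ring.
by split; rewrite (@derive_val _ _ _ _ _ _ _ (D _))
    !Svec_deltaR !Rvec_deltaR /=; ring.
Qed.

(** The multiplier of sgrad K is eliminated here, while [m] stays an unknown; the value of the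
    Casimir S.R determines it later, in [Sigma1P]. *)
Lemma rank1_hamHP : 0 < a ->
  rank1_point H intK p <->
  x ^+ 2 < a /\ exists m,
    [/\ S1 = m * R1 - g1 a x * R2, S2 = m * R2 + g1 a x * R1 &
      dx g1 a x * (S1 * R2 - S2 * R1) + dx g2 a x * g + dx g3 a x * S3
        + dx V a x - m * S3 + (g1 a x ^+ 2 + m ^+ 2) * x = 0].
Proof.
move=> a0; have [nu [B [[h0 h1 h2] [h3 h4 h5] HB]]] := hamH_partial a0.
have [[k0 k1 k2] [k3 k4 k5]] := sgrad_intK p.
have aE := dotp3 (Rvec p) (Rvec p).
have u0 := Svec_sgrad H p 0; have u1 := Svec_sgrad H p 1.
have u2 := Svec_sgrad H p 2; have u3 := Rvec_sgrad H p 0.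
have u4 := Rvec_sgrad H p 1; have u5 := Rvec_sgrad H p 2.
rewrite !ord3_add ?h0 ?h1 ?h2 ?h3 ?h4 ?h5 in u0 u1 u2 u3 u4 u5.
split.
- move=> r1; have K0 : sgrad intK p != 0.
    apply/negP => /eqP Kz; rewrite Kz in k0 k1 k3 k4.
    have z0 : S2 = 0 by apply/eqP; rewrite -oppr_eq0 -k0 ?Svec0 ?Rvec0.
    have z1 : S1 = 0 by rewrite -k1 ?Svec0 ?Rvec0.
    have z3 : R2 = 0 by apply/eqP; rewrite -oppr_eq0 -k3 ?Svec0 ?Rvec0.
    have z4 : R1 = 0 by rewrite -k4 ?Svec0 ?Rvec0.
    (* If sgrad K vanished, S and R would lie on the third axis; then sgrad H vanishes as well and
       the rank is 0. *)
    have Hz : sgrad H p = 0.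
      by apply: row6P; apply: ord3P; rewrite ?u0 ?u1 ?u2 ?u3 ?u4 ?u5 ?Svec0 ?Rvec0
        ?z0 ?z1 ?z3 ?z4; ring.
    move: r1; rewrite /rank1_point Kz Hz span_cons span_seq1 addvv dim_vline.
    by rewrite eqxx.
  have [l lE] := rank1P r1 K0.
  have sE i : Svec (sgrad H p) 0 i = l * Svec (sgrad intK p) 0 i by rewrite lE SvecZ.
  have rE i : Rvec (sgrad H p) 0 i = l * Rvec (sgrad intK p) 0 i by rewrite lE RvecZ.
  have q0 := sE 0; have q1 := sE 1; have q3 := rE 0; have q4 := rE 1; have q5 := rE 2.
  rewrite u0 k0 in q0; rewrite u1 k1 in q1; rewrite u3 k3 in q3.
  rewrite u4 k4 in q4; rewrite u5 k5 in q5.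
  (* At a pole the R-part of the proportionality reduces to [x * S2 = 0] and [x * S1 = 0] with [x]
     nonzero, which would make sgrad K vanish. *)
  have w0 : R1 ^+ 2 + R2 ^+ 2 != 0.
    apply/negP; rewrite paddr_eq0 ?sqr_ge0 // !sqrf_eq0 => /andP[/eqP z0 /eqP z1].
    have x0 : x != 0.
      by apply/negP => /eqP x0; move: a0; rewrite aE z0 z1 x0 !mulr0 !addr0 ltxx.
    have y1 : S2 = 0.
      apply: (mulfI x0); move: q3.
      by rewrite z0 z1 oppr0 !(mulr0, mul0r, subr0, addr0) => ->.
    have y0 : S1 = 0.
      apply: (mulfI x0); apply: oppr_inj; move: q4.
      by rewrite z0 z1 !(mulr0, mul0r, sub0r, addr0) oppr0.
    case/eqP: K0; apply: row6P; apply: ord3P;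
      by rewrite ?k0 ?k1 ?k2 ?k3 ?k4 ?k5 ?Svec0 ?Rvec0 ?z0 ?z1 ?y0 ?y1 ?oppr0.
  have xa : x ^+ 2 < a.
    rewrite aE -!expr2 ltrDr lt0r w0.
    by rewrite addr_ge0 ?sqr_ge0.
  split=> //; rewrite -HB //.
  exact: (proportional_algebra w0 q0 q1 q3 q4 q5).
- case=> xa [m [E1 E2 E]].
  have w0 : 0 < R1 ^+ 2 + R2 ^+ 2 by move: xa; rewrite aE -!expr2 ltrDr.
  rewrite -HB // in E.
  have BE : B = m * S3 - (g1 a x ^+ 2 + m ^+ 2) * x.
    by move/eqP: E; rewrite addr_eq0 subr_eq => /eqP ->; rewrite addrC.
  (* The multiplier is the S_3-derivative of H minus [(m + g2 a x) * x], as parallelism to R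
     requires in the third component. *)
  apply: (@rank1_of_prop _ _ _ _ (S3 / beta + g3 a x - m * x)).
    apply: row6P => i; rewrite ?SvecZ ?RvecZ.
      move: i; apply: ord3P.
      + by rewrite u0 k0 BE E1 E2; ring.
      + by rewrite u1 k1 BE E1 E2; ring.
      + by rewrite u2 k2 E1 E2; ring.
    move: i; apply: ord3P.
    + by rewrite u3 k3 E2; ring.
    + by rewrite u4 k4 E1; ring.
    + by rewrite u5 k5 E1 E2; ring.
  apply/negP => /eqP Kz; rewrite Kz in k3 k4.
  have z3 : R2 = 0 by apply/eqP; rewrite -oppr_eq0 -k3 ?Svec0 ?Rvec0.
  have z4 : R1 = 0 by rewrite -k4 ?Svec0 ?Rvec0.
  by move: w0; rewrite z3 z4 expr0n addr0 ltxx.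
Qed.

End RankOne.

(** * The quadratic equation for k and its two roots *)

Section Curves.
Variables (R : realType) (beta : R) (g1 g2 g3 V : R -> R -> R) (a g : R).
Hypothesis a0 : 0 < a.

(* (a - x^2)^2 times the left-hand side of the last equation in [rank1_hamHP],
   as a polynomial in k = S_3. *)
Definition momentum_poly (x k : R) : R :=
  a * x * k ^+ 2 + ((a - x ^+ 2) ^+ 2 * dx g3 a x - g * (a + x ^+ 2)) * k
  + (a - x ^+ 2) ^+ 2 * (x * g1 a x ^+ 2 - (a - x ^+ 2) * g1 a x * dx g1 a x
                         + g * dx g2 a x + dx V a x) + x * g ^+ 2.

(** The radicand in [kcurve]; the discriminant of [momentum_poly x] in k is [(a - x ^+ 2) ^+ 2]
    times it. *)
Definition discr (x : R) : R :=
  (g - (a + x ^+ 2) * dx g3 a x) ^+ 2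
  - 4 * a * x * (x * g1 a x ^+ 2 - (a - x ^+ 2) * g1 a x * dx g1 a x
                 + g * dx g2 a x + x * dx g3 a x ^+ 2 + dx V a x).

Lemma Dfun_discr x : Dfun g1 g2 g3 V a g x = discr x / (a - x ^+ 2) ^+ 2.
Proof. by rewrite /Dfun /discr; move: (_ ^+ 2)^-1 => u; ring. Qed.

Lemma momentum_poly_discr x k :
  4 * a * x * momentum_poly x k =
  (2 * a * x * k + ((a - x ^+ 2) ^+ 2 * dx g3 a x - g * (a + x ^+ 2))) ^+ 2
  - (a - x ^+ 2) ^+ 2 * discr x.
Proof. by rewrite /momentum_poly /discr; ring. Qed.

(** The completed square, centred at [kdeg], the midpoint of the two roots. *)
Lemma momentum_poly_kdeg x k : x != 0 ->
  4 * a * x * momentum_poly x k =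
  (2 * a * x * (k - kdeg g3 a g x)) ^+ 2 - (a - x ^+ 2) ^+ 2 * discr x.
Proof.
move=> x0; rewrite momentum_poly_discr /kdeg.
have := lt0r_neq0 a0 => an0.
by congr (_ ^+ 2 - _); field; rewrite ?an0 ?x0.
Qed.

Lemma momentum_poly_eq0 x k : x ^+ 2 < a -> x != 0 ->
  momentum_poly x k = 0 <->
  0 <= Dfun g1 g2 g3 V a g x /\
    (k = kcurve g1 g2 g3 V a g 1 x \/ k = kcurve g1 g2 g3 V a g (-1) x).
Proof.
move=> xa x0; have an0 := lt0r_neq0 a0.
have w0 : 0 < a - x ^+ 2 by rewrite subr_gt0.
have c0 : 2 * a * x != 0 by rewrite !mulf_neq0.
have kE e : kcurve g1 g2 g3 V a g e x =
    kdeg g3 a g x + e * ((a - x ^+ 2) / (2 * a * x) * Num.sqrt (discr x)) by [].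
have D0 : (0 <= Dfun g1 g2 g3 V a g x) = (0 <= discr x).
  by rewrite Dfun_discr pmulr_lge0 // invr_gt0 exprn_gt0.
have q0 : momentum_poly x k = 0 <->
    (2 * a * x * (k - kdeg g3 a g x)) ^+ 2 = (a - x ^+ 2) ^+ 2 * discr x.
  have d0 : 4 * a * x != 0 by rewrite !mulf_neq0.
  split=> [q|q].
    by apply/eqP; rewrite -subr_eq0 -momentum_poly_kdeg // q mulr0.
  by apply: (mulfI d0); rewrite momentum_poly_kdeg // q subrr mulr0.
rewrite q0 D0 !kE; split.
- move=> q; have d0 : 0 <= discr x.
    by rewrite -(pmulr_rge0 _ (exprn_gt0 2 w0)) -q sqr_ge0.
  (* Both sides are now squares, so their bases agree up to sign; each sign gives one branch. *)
  split=> //; move: q; rewrite -{1}(sqr_sqrtr d0) -exprMn => /eqP.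
  rewrite eqf_sqr => /orP[] /eqP q; [left|right];
    by rewrite -(subrK (kdeg g3 a g x) k) -(mulKf c0 (k - _)) q; field;
      rewrite ?an0 ?x0.
- case=> d0 [] ->; rewrite -{2}(sqr_sqrtr d0); field;
  by rewrite ?an0 ?x0.
Qed.

End Curves.

(** * Connected components of [Theta] *)

Lemma near_subset_component (R : realType) (A : set R) (x : R) :
  (\forall y \near x, A y) -> exists2 y, connected_component A x y & y != x.
Proof.
move=> [e /= e0 eA].
(* Any point of the ball other than its centre serves: the whole interval of radius [e] is connected
   and contained in [A]. *)
exists (x + e / 2); last by rewrite -subr_eq0 addrAC subrr add0r gt_eqF // divr_gt0.
exists `]x - e, x + e[%classic; last by rewrite /= in_itv /=; apply/andP; split; lra.
split.
- by rewrite /= in_itv /=; apply/andP; split; lra.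
- move=> y; rewrite /= in_itv /= => /andP[y1 y2]; apply: eA.
  by rewrite /= ltr_norml; apply/andP; split; lra.
- by apply/connected_intervalP; exact: interval_is_interval.
Qed.

Section Components.
Variables (R : realType) (g1 g2 g3 V : R -> R -> R) (a g : R).
Hypotheses (s1 : smooth_potential g1) (s2 : smooth_potential g2)
  (s3 : smooth_potential g3) (sV : smooth_potential V) (a0 : 0 < a).
Local Notation Theta := (Theta g1 g2 g3 V a g).
Local Notation discr := (discr g1 g2 g3 V a g).

Lemma discr_continuous (x : R) : x ^+ 2 < a -> discr y @[y --> x] --> discr x.
Proof.
move=> xa.
have [c1 d1] := dx_continuous s1 a0 xa.
have [c2 d2] := dx_continuous s2 a0 xa.
have [c3 d3] := dx_continuous s3 a0 xa.
have [c4 d4] := dx_continuous sV a0 xa.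
have i : y @[y --> x] --> x by exact: cvg_id.
have k (c : R) : c @[y --> x] --> c by exact: cvg_cst.
have sq (f : R -> R) (l : R) : f y @[y --> x] --> l -> f y ^+ 2 @[y --> x] --> l ^+ 2.
  by move=> fl; rewrite expr2; under eq_fun do rewrite expr2; exact: cvgM.
apply: cvgB.
  by apply: (sq); apply: cvgB; [|apply: cvgM => //; apply: cvgD => //; exact: sq].
apply: cvgM; first exact: cvgM.
apply: cvgD => //; apply: cvgD; last by apply: cvgM => //; exact: sq.
apply: cvgD; last exact: cvgM.
apply: cvgB; first by apply: cvgM => //; exact: sq.
by apply: cvgM => //; apply: cvgM => //; apply: cvgB => //; exact: sq.
Qed.

Lemma Theta_nbhs (x : R) : x ^+ 2 < a -> x != 0 -> 0 < discr x ->
  \forall y \near x, Theta y.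
Proof.
move=> xa x0 d0; near=> y; split.
- by near: y; exact: near_sqr_lt.
- near: y; exact: open_neq.
- rewrite Dfun_discr divr_ge0 ?sqr_ge0 //; apply: ltW; near: y.
  exact: (cvgr_gt (discr x) (discr_continuous xa)).
Unshelve. all: by end_near. Qed.

(** If [discr x] were positive, it would remain so nearby by continuity, and the component would
    contain a neighbourhood of [x]. *)
Lemma Theta0P x : Theta0 g1 g2 g3 V a g x ->
  [/\ Theta x, connected_component Theta x = [set x] & discr x = 0].
Proof.
case=> y Ty cy.
(* [Theta0] presents the singleton as the component of some [y]; since it contains [x], it is also
   the component of [x]. *)
have cyx : connected_component Theta y x by rewrite cy.
have Tx : Theta x by exact: connected_component_sub cyx.
have cx : connected_component Theta x = [set x].
  by rewrite -cy (same_connected_component cyx).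
split=> //; have [xa x0 D0] := Tx.
have d0 : 0 <= discr x.
  by move: D0; rewrite Dfun_discr pmulr_lge0 // invr_gt0 exprn_gt0 // subr_gt0.
apply/eqP; rewrite eq_le d0 andbT leNgt; apply/negP => d1.
have [z] := near_subset_component (Theta_nbhs xa x0 d1).
by rewrite cx => -> /eqP.
Qed.

Lemma Theta_dichotomy x : Theta x ->
  Theta0 g1 g2 g3 V a g x \/ exists2 I, Iset g1 g2 g3 V a g I & I x.
Proof.
move=> Tx; have xx : connected_component Theta x x by exact: connected_component_refl.
have [[y yx xy]|N] := pselect (exists2 y, connected_component Theta x y & x != y).
  right; exists (connected_component Theta x) => //; split; first by exists x.
  by exists x, y.
left; exists x => //; apply/seteqP; split=> [y yx|_ ->//].
by apply/eqP; rewrite eq_sym; apply: contra_notT N => xy; exists y.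
Qed.

End Components.

(** * The degenerate equation at x = 0 *)

Lemma momentum_poly0 (R : realType) (g1 g2 g3 V : R -> R -> R) (a g k : R) :
  momentum_poly g1 g2 g3 V a g 0 k =
  a * ((a * dx g3 a 0 - g) * k
       - a * (a * g1 a 0 * dx g1 a 0 - g * dx g2 a 0 - dx V a 0)).
Proof. by rewrite /momentum_poly; ring. Qed.

(** Without its quadratic term the equation is linear in [k], with slope proportional to
    [a * dx g3 a 0 - g], nonzero by hypothesis. The denominator of [k0] is this factor divided by
    [a]. *)
Lemma k0P (R : realType) (g1 g2 g3 V : R -> R -> R) (a g k : R) : 0 < a ->
  g <> a * dx g3 a 0 ->
  momentum_poly g1 g2 g3 V a g 0 k = 0 <-> k = k0 g1 g2 g3 V a g.
Proof.
move=> a0 ge; have an0 := lt0r_neq0 a0.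
have c0 : a * dx g3 a 0 - g != 0 by rewrite subr_eq0 eq_sym; apply/eqP.
have c1 : dx g3 a 0 - g / a != 0.
  by apply: contra_neq c0 => c1; rewrite -[g](divfK an0) [g / a * a]mulrC
    -mulrBr c1 mulr0.
rewrite momentum_poly0 /k0; split.
  move/eqP; rewrite mulf_eq0 (negbTE an0) /= subr_eq0 => /eqP E.
  by apply: (mulfI c0); rewrite E; field; rewrite an0 mulrC c0.
by move=> ->; field; rewrite an0 mulrC c0.
Qed.

(** * From points of rank one to their images under (H, K) *)

Lemma row3 (R : realType) (x y z : R) :
  exists u : 'rV[R]_3, [/\ u 0 0 = x, u 0 1 = y & u 0 2 = z].
Proof. by exists (\row_i nth 0 [:: x; y; z] i); rewrite !mxE. Qed.

(** Up to rotation about the third axis, a point of rank one is determined by x = R_3 and k = S_3,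
    so its image can be described by these two numbers and one polynomial equation. *)
Lemma Sigma1P (R : realType) (beta : R) (g1 g2 g3 V : R -> R -> R)
    (s1 : smooth_potential g1) (s2 : smooth_potential g2)
    (s3 : smooth_potential g3) (sV : smooth_potential V) (a g : R) (a0 : 0 < a) hk :
  Sigma1 (hamH beta g1 g2 g3 V) intK a g hk <->
  exists x k, [/\ x ^+ 2 < a, momentum_poly g1 g2 g3 V a g x k = 0 &
    hk = (hval beta g1 g2 g3 V a g k x, k)].
Proof.
split.
- case=> p [[pa pg]] /rank1_hamHP; rewrite pa pg.
  case/(_ s1 s2 s3 sV a0) => xa [m [E1 E2 E]] <-.
  exists (Rvec p 0 2), (Svec p 0 2).
  have aE : a = Rvec p 0 0 ^+ 2 + Rvec p 0 1 ^+ 2 + Rvec p 0 2 ^+ 2.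
    by rewrite -pa dotp3 !expr2.
  have w0 : a - Rvec p 0 2 ^+ 2 != 0 by rewrite subr_eq0 gt_eqF.
  have wE : Rvec p 0 0 ^+ 2 + Rvec p 0 1 ^+ 2 = a - Rvec p 0 2 ^+ 2.
    by rewrite aE; ring.
  (* The Casimir S.R ties [m] to S_3 and R_3; substituting this relation yields both the polynomial
     equation and the formula for h. *)
  have gE : g = m * (a - Rvec p 0 2 ^+ 2) + Svec p 0 2 * Rvec p 0 2.
    by rewrite -wE -pg dotp3 E1 E2; ring.
  have e12 : Svec p 0 0 * Rvec p 0 1 - Svec p 0 1 * Rvec p 0 0 =
      - g1 a (Rvec p 0 2) * (a - Rvec p 0 2 ^+ 2).
    by rewrite -wE E1 E2; ring.
  have n12 : Svec p 0 0 ^+ 2 + Svec p 0 1 ^+ 2 =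
      (m ^+ 2 + g1 a (Rvec p 0 2) ^+ 2) * (a - Rvec p 0 2 ^+ 2).
    by rewrite -wE E1 E2; ring.
  split=> //.
  + rewrite e12 in E; rewrite -[RHS](mulr0 ((a - Rvec p 0 2 ^+ 2) ^+ 2)) -E.
    by rewrite /momentum_poly gE; ring.
  + congr pair; rewrite /hamH /hval pa pg e12 n12.
    have -> : g - Svec p 0 2 * Rvec p 0 2 = m * (a - Rvec p 0 2 ^+ 2).
      by rewrite gE; ring.
    rewrite [(2 * beta)^-1]invfM.
    by move: beta^-1 => b; field.
- case=> x [k [xa P ->]].
  have w0 : 0 < a - x ^+ 2 by rewrite subr_gt0.
  have wn := lt0r_neq0 w0.
  pose m := (g - k * x) / (a - x ^+ 2).
  have gE : g = m * (a - x ^+ 2) + k * x by rewrite /m divfK // subrK.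
  (* By the rotational symmetry a representative with R_2 = 0 is enough: R = (r, 0, x), and the
     formulas for S_1 and S_2 then force S = (m r, g_1 r, k). *)
  pose r := Num.sqrt (a - x ^+ 2).
  have rE : r ^+ 2 = a - x ^+ 2 by rewrite sqr_sqrtr // ltW.
  have [u [u0 u1 u2]] := row3 (m * r) (g1 a x * r) k.
  have [v [v0 v1 v2]] := row3 r 0 x.
  have pS : Svec (row_mx u v) = u by exact: row_mxKl.
  have pR : Rvec (row_mx u v) = v by exact: row_mxKr.
  have pa : dotp v v = a.
    rewrite dotp3 v0 v1 v2 mulr0 addr0 -!expr2 rE; ring.
  have pg : dotp u v = g.
    by rewrite dotp3 v0 v1 v2 u0 u1 u2 mulr0 addr0 -mulrA -expr2 rE -gE.
  exists (row_mx u v).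
    split; first by split; rewrite ?pS pR.
    apply/rank1_hamHP; rewrite ?pS ?pR ?pa //; split; first by rewrite v2.
    exists m; rewrite v0 v1 v2 u0 u1 u2 pg; split; [by ring|by ring|].
    (* Multiplying twice by [a - x ^+ 2] turns the scalar equation into [momentum_poly]. *)
    apply: (mulfI wn); apply: (mulfI wn); rewrite [in RHS]mulr0 [in RHS]mulr0 -[RHS]P.
    have -> : m * r * 0 - g1 a x * r * r = - g1 a x * (a - x ^+ 2).
      by rewrite -rE; ring.
    by rewrite /momentum_poly gE; ring.
  rewrite /hamH /intK pS pR pa pg v0 v1 v2 u0 u1 u2; congr pair.
  rewrite /hval.
  have -> : g - k * x = m * (a - x ^+ 2) by rewrite gE; ring.
  have -> : m * r * 0 - g1 a x * r * r = - g1 a x * (a - x ^+ 2).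
    by rewrite -rE; ring.
  rewrite !exprMn rE [(2 * beta)^-1]invfM.
  by move: beta^-1 => b; field.
Qed.

(** * Sorting the zeros of the momentum polynomial into the four families *)

Unset Implicit Arguments.

Theorem theorem5 (R : realType) (beta : R) (g1 g2 g3 V : R -> R -> R)
    (beta_gt0 : 0 < beta)
    (g1_smooth : smooth_potential g1) (g2_smooth : smooth_potential g2)
    (g3_smooth : smooth_potential g3) (V_smooth : smooth_potential V)
    (a g : R) (a_gt0 : 0 < a) :
  Sigma1 (hamH beta g1 g2 g3 V) intK a g =
    (\bigcup_(I in Iset g1 g2 g3 V a g)
        (curve beta g1 g2 g3 V a g 1 @` I `|`
         curve beta g1 g2 g3 V a g (-1) @` I))
    `|` [set (hval beta g1 g2 g3 V a g (kdeg g3 a g x0) x0, kdeg g3 a g x0)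
          | x0 in Theta0 g1 g2 g3 V a g]
    `|` [set hk : R * R | g <> a * dx g3 a 0 /\
          hk = (h0 beta g1 g2 g3 V a g, k0 g1 g2 g3 V a g)]
    `|` [set hk : R * R |
          [/\ g = a * dx g3 a 0,
              a * g1 a 0 * dx g1 a 0 - a * dx g3 a 0 * dx g2 a 0 - dx V a 0 = 0
            & hk.1 = hparabola beta g1 g2 g3 V a hk.2]].
Proof.
have an0 := lt0r_neq0 a_gt0.
have zero_sq : 0 ^+ 2 < a by rewrite expr0n.
(* Where the radicand vanishes, both branches meet at the midpoint. *)
have kdegE e x : discr g1 g2 g3 V a g x = 0 ->
    kcurve g1 g2 g3 V a g e x = kdeg g3 a g x.
  by rewrite /discr /kcurve => ->; rewrite sqrtr0 !mulr0 addr0.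
have h0E : hval beta g1 g2 g3 V a g (k0 g1 g2 g3 V a g) 0 = h0 beta g1 g2 g3 V a g.
  by rewrite /hval /h0 !expr0n /= !mulr0 !subr0.
have hparE k : g = a * dx g3 a 0 ->
    hval beta g1 g2 g3 V a g k 0 = hparabola beta g1 g2 g3 V a k.
  move=> gE; rewrite /hval /hparabola gE [(2 * beta)^-1]invfM.
  by move: beta^-1 => b; field.
apply/seteqP; split=> [hk|hk].
- move=> /(Sigma1P _ g1_smooth g2_smooth g3_smooth V_smooth _ a_gt0) [x [k [xa P ->]]].
  have [x0|x0] := eqVneq x 0.
    rewrite x0 in P *.
    have [gE|/eqP gE] := eqVneq g (a * dx g3 a 0); [right|left; right].
      split=> //=; last exact: hparE.
      (* With zero slope, [P] no longer involves [k] and becomes the condition for the parabola. *)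
      move: P; rewrite momentum_poly0 gE subrr mul0r sub0r => /eqP.
      by rewrite mulf_eq0 (negbTE an0) oppr_eq0 mulf_eq0 (negbTE an0) /= => /eqP.
    by split=> //; rewrite ((k0P g1 g2 V k a_gt0 gE).1 P) h0E.
  (* A real root exists, so [x] lies in [Theta]; whether its component is degenerate decides between
     the isolated points and the curves. *)
  left; left; have [D kE] := (momentum_poly_eq0 g1 g2 g3 V g a_gt0 _ xa x0).1 P.
  have Tx : Theta g1 g2 g3 V a g x by [].
  have [T0|[I HI Ix]] := Theta_dichotomy Tx.
    right; exists x => //.
    have [_ _ d0] := Theta0P g1_smooth g2_smooth g3_smooth V_smooth a_gt0 T0.
    by case: kE => ->; rewrite kdegE.
  by left; exists I => //; case: kE => ->; [left|right]; exists x.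
- move=> H; apply/(Sigma1P _ g1_smooth g2_smooth g3_smooth V_smooth _ a_gt0).
  case: H => [[[[I [[y Ty yI] _] C]|[x T0 <-]]|[gE ->]]|[gE E hE]].
  (* The two signs are merged into one [e], so that both branches are handled at once. *)
  + have [e [x [Ix [eE <-]]]] : exists e x,
        I x /\ (e = 1 \/ e = -1) /\ curve beta g1 g2 g3 V a g e x = hk.
      by case: C => -[x Ix xE]; [exists 1|exists (-1)]; exists x; do !split=> //;
        [left|right].
    rewrite -yI in Ix; have [xa x0 D] := connected_component_sub Ix.
    exists x, (kcurve g1 g2 g3 V a g e x); split=> //.
    apply/(momentum_poly_eq0 g1 g2 g3 V g a_gt0 _ xa x0); split=> //.
    by case: eE => ->; [left|right].
  + have [[xa x0 D] _ d0] := Theta0P g1_smooth g2_smooth g3_smooth V_smooth a_gt0 T0.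
    exists x, (kdeg g3 a g x); split=> //.
    apply/(momentum_poly_eq0 g1 g2 g3 V g a_gt0 _ xa x0); split=> //.
    by left; rewrite kdegE.
  + exists 0, (k0 g1 g2 g3 V a g); split=> //; first exact/k0P.
    by rewrite h0E.
  + exists 0, hk.2; split=> //; last by rewrite hparE // -hE -surjective_pairing.
    by rewrite momentum_poly0 gE E subrr mul0r mulr0 subr0 mulr0.
Qed.
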